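(* Let $X,Y$ be real Banach spaces such that $X$ and $Y^*$ are reflexive, smooth and 2-convex, let $T:X\to Y$ be linear and continuous, let $f\in\Gamma(X)$, $g\in\Gamma(Y)$ be nonnegative, and let $(\bar x,-\bar p)\in X\times Y^*$ be a solution of the saddle-point problem $$\min_{x\in X}\max_{p\in Y^*}\; -\langle Tx,p\rangle_Y+f(x)-g^*(-p).$$ Let $C_X,C_{Y^*}>0$ be constants with $\mathcal{B}_X(x,u)\ge \frac{C_X}{2}\|x-u\|_X^2$ for all $x,u\in X$ and $\mathcal{B}_{Y^*}(y^*,p)\ge\frac{C_{Y^*}}{2}\|y^*-p\|_{Y^*}^2$ for all $y^*,p\in Y^*$. Assume there is $\gamma>0$ such that $$f(u)-f(x)\ge\langle u-x,x^*\rangle_X+\gamma\,\mathcal{B}_X(u,x)\qquad\text{for all }x,u\in X,\ x^*\in\partial f(x).$$ Let $\sigma_0,\tau_0>0$ with $\sqrt{\sigma_0\tau_0}\,\|T\|\le\min\{C_X,C_{Y^*}\}$ and for $k\ge0$ set $$\theta_k:=(1+\gamma\tau_k)^{-1/2},\qquad \tau_{k+1}:=\theta_k\tau_k,\qquad \sigma_{k+1}:=\theta_k^{-1}\sigma_k.$$ Let $(x_0,p_0)\in X\times Y^*$, $\hat x_0:=x_0$, and let $(x_k,p_k)_{k\in\mathbb{N}}$ be generated by $$p_{k+1}=(\sigma_k\,\partial g^*+J_{Y^*})^{-1}\big(J_{Y^*}(p_k)+\sigma_k T\hat x_k\big),\quad x_{k+1}=(\tau_k\,\partial f+J_X)^{-1}\big(J_X(x_k)-\tau_k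 T^*p_{k+1}\big),\quad \hat x_{k+1}=x_{k+1}+\theta_k(x_{k+1}-x_k).$$ Then for every $\epsilon>0$ there exists $N_0\in\mathbb{N}$ such that for all $N\ge N_0$ $$\mathcal{B}_X(\bar x,x_N)\le\frac{4+4\epsilon}{N^2}\left(\frac{\mathcal{B}_X(\bar x,x_0)}{\gamma^2\tau_0^2}+\frac{\mathcal{B}_{Y^*}(\bar p,p_0)}{\gamma^2\sigma_0\tau_0}\right).$$
   Context: For a Banach space $Z$ with dual $Z^*$ write $\langle z,z^*\rangle_Z=z^*(z)$. $\Gamma(Z)$ is the set of proper, convex, lower semicontinuous functions $Z\to(-\infty,+\infty]$; $h^*$ denotes the Fenchel conjugate and $\partial h(z)=\{z^*\in Z^*: \langle u-z,z^*\rangle_Z\le h(u)-h(z)\ \forall u\in Z\}$ the subdifferential. $Z$ is 2-convex if there is $C>0$ such that $\delta_Z(\epsilon):=\inf\{1-\|\tfrac12(x+u)\|_Z:\|x\|_Z=\|u\|_Z=1,\ \|x-u\|_Z\ge\epsilon\}\ge C\epsilon^2$ for all $\epsilon\in[0,2]$. $J_Z=\partial\big(\tfrac12\|\cdot\|_Z^2\big)$ is the normalized duality mapping; $J_X:X\to X^*$ and $J_{Y^*}:Y^*\to Y^{**}=Y$ are single-valued bijections in the present setting, with inverses $J_{X^*}$ and $J_Y$. For $h\in\Gamma(Z)$, $Z$ reflexive, and $\tau>0$, the generalized resolvent $(\tau\,\partial h+J_Z)^{-1}:Z^*\to Z$ is well-defined and single-valued: it maps $u$ to the unique $z$ with $u\in\tau\,\partial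 h(z)+J_Z(z)$ (for $h=g^*$ on $Y^*$ it maps $Y\to Y^*$). The Bregman distance is $\mathcal{B}_Z(u,x):=\tfrac12\|u\|_Z^2-\tfrac12\|x\|_Z^2-\langle u-x,J_Z(x)\rangle_Z$. Since $X$ and $Y^*$ are reflexive, smooth and 2-convex, constants $C_X,C_{Y^*}$ as in the claim exist. A pair $(\bar x,-\bar p)\in X\times Y^*$ solves the saddle-point problem iff $-T^*\bar p\in\partial f(\bar x)$ and $T\bar x\in\partial g^*(\bar p)$. *)

(* Defs.v *)
From HB Require Import structures.
From mathcomp Require Import all_boot all_order all_algebra.
From mathcomp Require Import all_classical all_reals all_analysis.
From mathcomp Require Import ring lra.
Import Order.TTheory GRing.Theory Num.Theory numFieldNormedType.Exports.

Set Implicit Arguments.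
Unset Strict Implicit.
Unset Printing Implicit Defensive.

Local Open Scope classical_set_scope.
Local Open Scope ring_scope.

Section OperatorNorm.
Context {R : realType} {V W : normedModType R}.

Definition opnorm (F : V -> W) : R :=
  sup [set `|F x| | x in [set x : V | `|x| <= 1]].

Lemma opnorm_has_sup (F : {linear V -> W}) : continuous F ->
  has_sup [set `|F x| | x in [set x : V | `|x| <= 1]].
Proof.
move=> cF; split; first by exists `|F 0|, 0 => //=; rewrite normr0.
have /bounded_funP /(_ 1) [M hM] := (linear_bounded_continuous F).2 cF.
by exists M => _ [x /= x1 <-]; exact: hM.
Qed.

Lemma opnorm_ge0 (F : {linear V -> W}) : continuous F -> 0 <= opnorm F.
Proof.
move=> cF; apply: le_trans (normr_ge0 (F 0)) _.
apply: sup_upper_bound; first exact: opnorm_has_sup.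
by exists 0 => //=; rewrite normr0.
Qed.

Lemma opnormP (F : {linear V -> W}) : continuous F ->
  forall x, `|F x| <= opnorm F * `|x|.
Proof.
move=> cF x; have [->|x0] := eqVneq x 0; first by rewrite linear0 !normr0 mulr0.
rewrite -ler_pdivrMr ?normr_gt0//.
have -> : `|F x| / `|x| = `|F (`|x|^-1 *: x)|.
  by rewrite linearZ normrZ normfV normr_id mulrC.
apply: sup_upper_bound; first exact: opnorm_has_sup.
exists (`|x|^-1 *: x) => //=.
by rewrite normrZ normfV normr_id mulVf// normr_eq0.
Qed.

Lemma opnorm_le (F : {linear V -> W}) (M : R) : continuous F -> 0 <= M ->
  (forall x, `|F x| <= M * `|x|) -> opnorm F <= M.
Proof.
move=> cF M0 FM; apply: ge_sup; first by case: (opnorm_has_sup cF).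
move=> _ [x /= x1 <-]; apply: le_trans (FM x) _.
by rewrite -[leRHS]mulr1 ler_wpM2l.
Qed.

End OperatorNorm.

Section Dual.
Context {R : realType} (Z : normedModType R).

Definition dual_pred : {pred Z -> R^o} :=
  [pred F | `[< linear F /\ continuous F >]].

Record dual : Type := Dual { dual_fun :> Z -> R^o ; _ : dual_fun \in dual_pred }.

HB.instance Definition _ := [isSub for dual_fun].
HB.instance Definition _ := [Choice of dual by <:].

Lemma dual_submod_closed : submod_closed dual_pred.
Proof.
split.
  apply/asboolP; split; last exact: cst_continuous.
  by move=> a u v; rewrite /= scaler0 addr0.
move=> a F G /asboolP[lF cF] /asboolP[lG cG]; apply/asboolP; split.
  move=> b u v; rewrite /= -[LHS]/(a *: F (b *: u + v) + G (b *: u + v)).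
  rewrite -[RHS]/(b *: (a *: F u + G u) + (a *: F v + G v)) lF lG.
  by rewrite !scalerDr addrACA !scalerA mulrC.
move=> x; apply: (@cvgD _ R^o); last exact: cG.
by apply: (@cvgZr _ R^o); exact: cF.
Qed.
HB.instance Definition _ :=
  GRing.isSubmodClosed.Build R (Z -> R^o) dual_pred dual_submod_closed.
HB.instance Definition _ := [SubChoice_isSubLmodule of dual by <:].

Lemma dual_is_linear (p : dual) : linear p.
Proof. by case: p => F /= /asboolP[]. Qed.
HB.instance Definition _ (p : dual) :=
  GRing.isLinear.Build R Z R^o *:%R p (dual_is_linear p).

Lemma dual_continuous (p : dual) : continuous p.
Proof. by case: p => F /= /asboolP[]. Qed.

Lemma dual_ext (p q : dual) : p =1 q -> p = q.
Proof. by move=> pq; apply/val_inj/funext. Qed.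

Lemma dualD (p q : dual) z : (p + q) z = p z + q z. Proof. by []. Qed.
Lemma dualZ a (p : dual) z : (a *: p) z = a * p z. Proof. by []. Qed.
Lemma dualN (p : dual) z : (- p) z = - p z. Proof. by []. Qed.

Let dual_norm (p : dual) : R := opnorm p.

Let dual_normD p q : dual_norm (p + q) <= dual_norm p + dual_norm q.
Proof.
apply: opnorm_le; first exact: dual_continuous.
  by rewrite addr_ge0// opnorm_ge0//; exact: dual_continuous.
move=> x; rewrite mulrDl; apply: le_trans (ler_normD (p x) (q x)) _.
by rewrite lerD// opnormP//; exact: dual_continuous.
Qed.

Let dual_normZ_le (a : R) p : dual_norm (a *: p) <= `|a| * dual_norm p.
Proof.
apply: opnorm_le; first exact: dual_continuous.
  by rewrite mulr_ge0// opnorm_ge0//; exact: dual_continuous.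
move=> x; rewrite -[X in Num.norm X]/(a * p x) normrM -mulrA ler_wpM2l// opnormP//.
exact: dual_continuous.
Qed.

Let dual_normZ (a : R) p : dual_norm (a *: p) = `|a| * dual_norm p.
Proof.
apply/eqP; rewrite eq_le dual_normZ_le /=.
have [->|a0] := eqVneq a 0.
  by rewrite normr0 mul0r opnorm_ge0//; exact: dual_continuous.
rewrite -ler_pdivlMl ?normr_gt0// -normfV.
by apply: le_trans (dual_normZ_le _ _); rewrite scalerA mulVf// scale1r.
Qed.

Let dual_norm0_eq0 p : dual_norm p = 0 -> p = 0.
Proof.
move=> p0; apply: dual_ext => x; apply/eqP.
have := opnormP (@dual_continuous p) x.
by rewrite -/(dual_norm p) p0 mul0r normr_le0.
Qed.

HB.instance Definition _ := Lmodule_isNormed.Build R dual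
  dual_normD dual_normZ dual_norm0_eq0.

Lemma dual_normE (p : dual) : `|p| = opnorm p. Proof. by []. Qed.

Lemma dual_normP (p : dual) z : `|p z| <= `|p| * `|z|.
Proof. exact/opnormP/dual_continuous. Qed.

End Dual.

Section Adjoint.
Context {R : realType} {X Y : normedModType R}.
Variables (T : {linear X -> Y}) (cT : continuous T).

Lemma adjoint_subproof (p : dual Y) :
  ((fun x => p (T x)) : X -> R^o) \in @dual_pred R X.
Proof.
apply/asboolP; split; first by move=> a u v; rewrite !linearP.
by move=> x; apply: continuous_comp; [exact: cT | exact: dual_continuous].
Qed.

Definition adjoint (p : dual Y) : dual X := Dual (adjoint_subproof p).

End Adjoint.

Section Bidual.
Context {R : realType} {Z : normedModType R}.

Lemma evaluation_subproof (z : Z) :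
  ((fun p : dual Z => p z) : dual Z -> R^o) \in @dual_pred R (dual Z).
Proof.
have lz : linear ((fun p : dual Z => p z) : dual Z -> R^o) by [].
pose F : {linear dual Z -> R^o} := HB.pack ((fun p : dual Z => p z) : dual Z -> R^o)
  (GRing.isLinear.Build R (dual Z) R^o *:%R _ lz).
apply/asboolP; split => //; apply: (@bounded_linear_continuous R (dual Z) R^o F).
apply/bounded_funP => r; exists (r * `|z|) => p pr.
by apply: le_trans (dual_normP p z) _; rewrite ler_wpM2r.
Qed.

(* The canonical embedding of Z into its bidual. *)
Definition evaluation (z : Z) : dual (dual Z) := Dual (evaluation_subproof z).

End Bidual.

Section Geometry.
Context {R : realType} (Z : normedModType R).

Definition reflexive_space := forall phi : dual (dual Z), exists z, phi = evaluation z.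

Definition smooth_space :=
  forall z : Z, z != 0 -> exists! p : dual Z, `|p| = 1 /\ p z = `|z|.

(* Extended-real valued: the infimum is +oo when no pair (x, u) is admissible. *)
Definition convexity_modulus (eps : R) : \bar R :=
  ereal_inf [set t | exists x u : Z, [/\ `|x| = 1, `|u| = 1, eps <= `|x - u|
                     & t = (1 - `|2^-1 *: (x + u)|)%:E]].

Definition two_convex := exists2 C : R, 0 < C &
  forall eps, 0 <= eps <= 2 -> ((C * eps ^+ 2)%:E <= convexity_modulus eps)%E.

End Geometry.

Section ConvexFunctions.
Context {R : realType} {Z : normedModType R}.
Implicit Types h : Z -> \bar R.

Definition proper h :=
  (forall z, h z != -oo%E) /\ (exists z, (h z < +oo)%E).

Definition convex_ereal h := forall (x y : Z) (t : R), 0 <= t <= 1 ->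
  (h (t *: x + (1 - t) *: y)%R <= t%:E * h x + (1 - t)%:E * h y)%E.

Definition Gamma h := [/\ proper h, convex_ereal h & lower_semicontinuous h].

Definition fenchel h (p : dual Z) : \bar R :=
  ereal_sup [set ((p z)%:E - h z)%E | z in [set: Z]].

Definition subdiff h (z : Z) : set (dual Z) :=
  [set p | forall u, ((p (u - z))%:E <= h u - h z)%E].

Definition half_sqnorm (z : Z) : \bar R := (2^-1 * `|z| ^+ 2)%:E.

(* The duality mapping is the set-valued map [subdiff half_sqnorm]; on a smooth
   space it is single-valued (see [subdiff_half_sqnorm]), and [duality_map]
   denotes its value. *)
Definition duality_map (z : Z) : dual Z := get (subdiff half_sqnorm z).

Definition bregman (u x : Z) : R :=
  2^-1 * `|u| ^+ 2 - 2^-1 * `|x| ^+ 2 - duality_map x (u - x).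

(* (tau * subdiff h + J)^-1 as a set-valued map. *)
Definition resolvent h (tau : R) (u : dual Z) : set Z :=
  [set z | exists2 p, subdiff h z p & u = tau *: p + duality_map z].

End ConvexFunctions.

Section SaddlePoint.
Context {R : realType} {X Y : normedModType R}.

Definition saddle_point {A B : Type} (L : A -> B -> \bar R) (a : A) (b : B) :=
  (forall b', (L a b' <= L a b)%E) /\ (forall a', (L a b <= L a' b)%E).

(* The addition of \bar R makes this -oo where f x = +oo = fenchel g (- p);
   this convention plays no role, see [saddle_point_lagrangianP]. *)
Definition lagrangian (T : X -> Y) (f : X -> \bar R) (g : Y -> \bar R)
    (x : X) (p : dual Y) : \bar R :=
  (- (p (T x))%:E + f x - fenchel g (- p)%R)%E.

End SaddlePoint.

Section Facts.
Context {R : realType}.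

Let le_perturb (a b c : R) : 0 <= c ->
  (forall t : R, 0 < t -> t < 1 -> a <= b + t * c) -> a <= b.
Proof.
move=> c0 H; apply/ler_addgt0Pr => e e0.
have d0 : 0 < c + e + 1 by rewrite ltr_wpDl// addr_ge0// ltW.
have t0 : 0 < e / (c + e + 1) by rewrite divr_gt0.
have t1 : e / (c + e + 1) < 1 by rewrite ltr_pdivrMr// mul1r; lra.
apply: (le_trans (H _ t0 t1)); rewrite lerD2l.
by rewrite mulrAC ler_pdivrMr// ler_pM2l//; lra.
Qed.

Let subdiff_half_sqnorm_norm (Z : normedModType R) (z : Z) (p : dual Z) :
  subdiff half_sqnorm z p ->
  (forall v, p v <= `|z| * `|v|) /\ `|z| ^+ 2 <= p z.
Proof.
move=> dp; split=> [v|].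
  apply: (@le_perturb _ _ (2^-1 * `|v| ^+ 2)) => [|t t0 _].
    by rewrite mulr_ge0// sqr_ge0.
  have := dp (z + t *: v); rewrite addrC addKr lee_fin linearZ/= => H.
  rewrite -(ler_pM2l t0); apply: (le_trans H).
  have N : `|z + t *: v| <= `|z| + t * `|v|.
    by rewrite (le_trans (ler_normD _ _))// normrZ gtr0_norm.
  have N2 : `|z + t *: v| ^+ 2 <= (`|z| + t * `|v|) ^+ 2.
    by rewrite ler_pXn2r// nnegrE// addr_ge0// mulr_ge0// ltW.
  by lra.
apply: (@le_perturb _ _ (2^-1 * `|z| ^+ 2)) => [|t t0 t1].
  by rewrite mulr_ge0// sqr_ge0.
have := dp ((1 - t) *: z).
rewrite scalerBl scale1r addrC addKr lee_fin linearN linearZ/=.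
have -> : z - t *: z = (1 - t) *: z by rewrite scalerBl scale1r.
rewrite normrZ ger0_norm ?subr_ge0 ?(ltW t1)// exprMn => H.
have {}H : t * (`|z| ^+ 2 - t * (2^-1 * `|z| ^+ 2)) <= t * p z.
  rewrite -[t * p z]/(t *: (p z : R^o)); apply: le_trans (_ : _ <= - - (t *: (p z : R^o))) _; last by rewrite opprK.
  rewrite lerNr; apply: (le_trans H); lra.
by move: H; rewrite ler_pM2l//; lra.
Qed.

Lemma subdiff_half_sqnorm (Z : normedModType R) (z : Z) :
  smooth_space Z -> subdiff half_sqnorm z = [set duality_map z].
Proof.
move=> smZ.
suff [p0 dp0 p0_uniq] : exists2 p0, subdiff half_sqnorm z p0 &
    forall p, subdiff half_sqnorm z p -> p = p0.
  rewrite /duality_map (get_unique dp0 p0_uniq).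
  by apply/seteqP; split=> [p /p0_uniq|p ->].
have [->|z0] := eqVneq z 0.
  exists 0 => [u|p /subdiff_half_sqnorm_norm[pv _]].
    rewrite lee_fin -[X in X <= _]/(0 : R) normr0 expr0n /= mulr0 !subr0.
    by rewrite mulr_ge0// sqr_ge0.
  apply: dual_ext => v; apply/eqP; rewrite eq_le.
  have := pv v; have := pv (- v); rewrite normr0 !mul0r linearN oppr_le0 => -> ->.
  by [].
have nz0 : 0 < `|z| by rewrite normr_gt0.
have [q [[q1 qz] q_uniq]] := smZ z z0.
exists (`|z| *: q) => [u|p /subdiff_half_sqnorm_norm[pv pz]].
  rewrite lee_fin -[(`|z| *: q) (u - z)]/(`|z| * q (u - z)) linearB/= qz.
  have qu : q u <= `|u|.
    by rewrite (le_trans (ler_norm _))// (le_trans (dual_normP q u))// q1 mul1r.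
  have : `|z| * q u <= `|z| * `|u| by rewrite ler_pM2l.
  have := sqr_ge0 (`|z| - `|u|); lra.
have p_le : `|p| <= `|z|.
  apply: opnorm_le; [exact: dual_continuous|by []|move=> v].
  by rewrite ler_norml pv andbT lerNl -[- p v]/(- (p v)) -linearN -(normrN v) pv.
have pz_le : p z <= `|p| * `|z| := le_trans (ler_norm _) (dual_normP p z).
have p_ge : `|z| <= `|p| by rewrite -(ler_pM2r nz0) -expr2; exact: le_trans pz_le.
have pE : `|p| = `|z| by apply/eqP; rewrite eq_le p_le.
have pzE : p z = `|z| ^+ 2.
  by apply/eqP; rewrite eq_le pz andbT expr2 -{1}pE.
rewrite (q_uniq (`|z|^-1 *: p)) ?scalerA ?divff ?scale1r// ?gt_eqF//.
split; first by rewrite normrZ normfV normr_id pE mulVf// gt_eqF.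
by rewrite -[LHS]/(`|z|^-1 * p z) pzE expr2 mulrA mulVf ?mul1r// gt_eqF.
Qed.

Lemma saddle_point_lagrangianP (X Y : normedModType R) (T : {linear X -> Y})
    (cT : continuous T) (f : X -> \bar R) (g : Y -> \bar R) (x : X) (p : dual Y) :
  Gamma f -> Gamma g -> (forall y, (0 <= g y)%E) ->
  saddle_point (lagrangian T f g) x (- p) <->
  subdiff f x (- adjoint cT p) /\ subdiff (fenchel g) p (evaluation (T x)).
Proof.
case=> -[fNy [x1 fx1]] _ _ [[gNy [y0 gy0]] _ _] g0.
have gsNy q : fenchel g q != -oo%E.
  have : ((q y0)%:E - g y0 <= fenchel g q)%E by apply: ereal_sup_ubound; exists y0.
  move: gy0 (gNy y0); case: (g y0) => // r _ _; apply: contraTN => /eqP ->.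
  by rewrite -EFinB leNgt ltNyr.
have gs0 : (fenchel g 0%R <= 0)%E.
  apply: ge_ereal_sup => _ [y _ <-].
  by rewrite -[(0 : dual Y) y]/(0 : R) sub0e oppe_le0.
have LE x' : lagrangian T f g x' (- p) = ((p (T x'))%:E + f x' - fenchel g p)%E.
  by rewrite /lagrangian opprK dualN EFinN oppeK.
split.
  case=> h1 h2.
  have [r0 gs0E] : exists r, fenchel g 0%R = r%:E.
    by move: (gsNy 0) gs0; case: (fenchel g 0%R) => [r _ _|//|//]; exists r.
  have [r1 fx1E] : exists r, f x1 = r%:E.
    by move: (fNy x1) fx1; case: (f x1) => [r _ _|//|//]; exists r.
  have := h1 0; rewrite LE /lagrangian oppr0 gs0E -[(0 : dual Y) (T x)]/(0 : R).
  have := h2 x1; rewrite !LE fx1E.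
  move: (gsNy p) (fNy x).
  case fxE: (f x) => [r| |//]; case gsE: (fenchel g p) => [s| |] _ _ // _ _.
  split=> [u|q].
    have := h2 u; rewrite !LE fxE gsE -[(- adjoint cT p) (u - x)]/(- p (T (u - x))).
    rewrite !linearB/=.
    move: (fNy u); case: (f u) => [v|//|//] _; last by move=> _; rewrite leey.
    rewrite -?EFinN -?EFinD !lee_fin; lra.
  have := h1 (- q); rewrite LE /lagrangian opprK dualN EFinN oppeK fxE gsE.
  rewrite -[evaluation (T x) _]/((q - p) (T x)) dualD dualN.
  move: (gsNy q); case: (fenchel g q) => [v|//|//] _; last by move=> _; rewrite leey.
  rewrite -?EFinN -?EFinD !lee_fin; lra.
case=> h1 h2.
have [r fxE] : exists r, f x = r%:E.
  have := h1 x1; move: (fNy x) (fNy x1) fx1.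
  by case: (f x) (f x1) => [r| |] // [r1| |] //; exists r.
have [s gsE] : exists s, fenchel g p = s%:E.
  have := h2 0; move: (gsNy p) (gsNy 0) gs0.
  by case: (fenchel g p) (fenchel g 0%R) => [s| |] // [s1| |] //; exists s.
split=> [q|u].
  have := h2 (- q); rewrite LE /lagrangian fxE gsE.
  rewrite -[evaluation (T x) _]/((- q - p) (T x)) dualD !dualN.
  move: (gsNy (- q)); case: (fenchel g (- q)%R) => [v|//|//] _; last by move=> _; rewrite leNye.
  rewrite -?EFinN -?EFinD !lee_fin; lra.
have := h1 u; rewrite !LE fxE gsE -[(- adjoint cT p) (u - x)]/(- p (T (u - x))).
rewrite !linearB/=.
move: (fNy u); case: (f u) => [v|//|//] _; last by move=> _; rewrite leey.
rewrite -?EFinN -?EFinD !lee_fin; lra.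
Qed.

End Facts.

(* Main.v *)
Require Import Defs.
From HB Require Import structures.
From mathcomp Require Import all_boot all_order all_algebra.
From mathcomp Require Import all_classical all_reals all_analysis.
From mathcomp Require Import ring lra.
Import Order.TTheory GRing.Theory Num.Theory numFieldNormedType.Exports.
Local Open Scope classical_set_scope.
Local Open Scope ring_scope.

(** Both updates are resolvent steps, so each one gives, through the
three-point identity of the Bregman distance, a one-step estimate against the
saddle point [resolvent_step]; the two are used with strong convexity constant
[gamma] for [f] and [0] for the conjugate of [g].  Divide the estimate for [x]
by [tau k ^+ 2] and the one for [p] by [s = sigma k * tau k], which does not
depend on [k], and add them.  The saddle-point coupling terms then reduce to
[(p k.+1 - pbar) (T (x k.+1 - xhat k)) / tau k], and the extrapolation [xhat]
makes this telescope up to an error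
[(p k.+1 - p k) (T (x k - x k.-1)) / tau k.-1].  The bound on
[sqrt s * opnorm T] lets the squared increments of the iterates, controlled by
the Bregman terms, absorb this error [coupling_bound].  Hence the quantity [energy] does not increase along the iteration [energy_decreases]:
the factor [1 + gamma * tau k] won from strong convexity is exactly what is
needed to replace [tau k] by [tau k.+1] in the weight of the primal term.  The
same absorption argument shows that the energy dominates
[bregman xbar x / tau ^+ 2] [energy_lower_bound], so that
[bregman xbar (x N)] is at most [tau N ^+ 2] times the initial energy.

It remains to know how fast [tau] tends to zero.  The numbers
[a k = (gamma * tau k)^-1] satisfy [a k.+1 ^+ 2 = a k ^+ 2 + a k]; they tend to
infinity with increments tending to [1 / 2], so eventually [a N >= N * b] for
every [b < 1 / 2] [sqrt_recurrence_asymptotics], that is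
[gamma * tau N <= (1 + o(1)) * 2 / N]. *)

(** * Bregman distances and resolvent steps *)

Section Resolvents.
Context {R : realType} {Z : normedModType R}.
Implicit Types (z u : Z) (w : dual Z).

Lemma dualB w z u : w (z - u) = w z - w u :> R.
Proof. exact: (linearB w). Qed.

Lemma dual_addZ w (a : R) z u : w (z + a *: u) = w z + a * w u :> R.
Proof. by rewrite linearD linearZ. Qed.

Lemma evaluationE z w : evaluation z w = w z. Proof. by []. Qed.

Lemma bregman_three_points (u z z' : Z) :
  bregman u z = bregman u z' + bregman z' z + (duality_map z' - duality_map z) (u - z').
Proof. by rewrite /bregman dualD dualN !dualB; lra. Qed.

(** For adding two subgradient inequalities between the same pair of points.  As
[+oo - +oo] and [-oo - -oo] are both [-oo] in [\bar R], infinite [u] or [v]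
contradict one of the premises. *)
Lemma le0_of_opposite_differences (a b : R) (u v : \bar R) :
  (a%:E <= u - v)%E -> (b%:E <= v - u)%E -> a + b <= 0.
Proof.
case: u v => [u| |] [v| |] //; rewrite -?EFinN -?EFinD ?lee_fin; lra.
Qed.

(** The optimality condition of the step says that
[tau^-1 *: (J z - J z') + w] is a subgradient of [h] at [z'], [J] being the
duality mapping.  Adding its (strong) subgradient inequality at [zbar] to the
one of [wbar] at [z'] makes the values of [h] cancel, and
[bregman_three_points] turns the pairing with [J z - J z'] into Bregman
distances. *)
Lemma resolvent_step (h : Z -> \bar R) (mu tau : R) z z' zbar w wbar :
  (forall u v v', subdiff h u v' ->
    ((v' (v - u) + mu * bregman v u)%:E <= h v - h u)%E) ->
  0 < tau -> subdiff h zbar wbar ->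
  resolvent h tau (duality_map z + tau *: w) z' ->
  (1 + tau * mu) * bregman zbar z' + bregman z' z + tau * (w - wbar) (zbar - z')
    <= bregman zbar z.
Proof.
move=> h_strong tau0 zbar_sol [xi z'_xi stepE].
have mono := le0_of_opposite_differences _ _ _ _ (h_strong _ zbar _ z'_xi) (zbar_sol z').
have xiE : tau * xi (zbar - z') = (duality_map z - duality_map z') (zbar - z')
    + tau * w (zbar - z').
  have := congr1 (fun q : dual Z => q (zbar - z') : R) stepE.
  by rewrite !dualD !dualZ dualN => ?; lra.
rewrite (bregman_three_points zbar z z').
have : tau * (xi (zbar - z') + mu * bregman zbar z' + wbar (z' - zbar)) <= 0.
  by rewrite pmulr_rle0.
move: xiE; rewrite !dualD !dualN !dualB; lra.
Qed.

End Resolvents.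

(** * Absorbing the coupling term *)

Section Coupling.
Context {R : realType} {X Y : normedModType R}.

Lemma adjointE (T : {linear X -> Y}) (cT : continuous T) (q : dual Y) (x : X) :
  adjoint cT q x = q (T x).
Proof. by []. Qed.

(** Young's inequality for the rescaled norms [`|q| / sqrt s] and [`|v| / t],
whose product carries the factor [sqrt s * opnorm T]. *)
Lemma coupling_bound (T : {linear X -> Y}) (C C' s t : R) (q : dual Y) (v : X) :
  continuous T -> 0 < s -> 0 < t -> Num.sqrt s * opnorm T <= Num.min C C' ->
  `|q (T v)| / t <= C' / 2 * `|q| ^+ 2 / s + C / 2 * `|v| ^+ 2 / t ^+ 2.
Proof.
move=> cT s0 t0; rewrite le_min => /andP[TC TC'].
have r0 : 0 < Num.sqrt s by rewrite sqrtr_gt0.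
set r := Num.sqrt s in r0 TC TC' *.
have -> : s = r ^+ 2 by rewrite sqr_sqrtr// ltW.
set a := `|q| / r; set b := `|v| / t.
have a0 : 0 <= a by rewrite divr_ge0// ltW.
have b0 : 0 <= b by rewrite divr_ge0// ltW.
have qTv : `|q (T v)| / t <= r * opnorm T * (a * b).
  have -> : r * opnorm T * (a * b) = `|q| * (opnorm T * `|v|) / t.
    by rewrite /a /b; field; rewrite !gt_eqF.
  rewrite ler_pM2r ?invr_gt0//; apply: le_trans (dual_normP q (T v)) _.
  by rewrite ler_wpM2l// opnormP.
have -> : C' / 2 * `|q| ^+ 2 / r ^+ 2 = C' / 2 * a ^+ 2.
  by rewrite /a; field; rewrite gt_eqF.
have -> : C / 2 * `|v| ^+ 2 / t ^+ 2 = C / 2 * b ^+ 2.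
  by rewrite /b; field; rewrite gt_eqF.
apply: le_trans qTv _.
have K0 : 0 <= r * opnorm T by rewrite mulr_ge0 ?opnorm_ge0// ltW.
set K := r * opnorm T in TC TC' K0 *.
have : 0 <= K * (a - b) ^+ 2 by rewrite mulr_ge0// sqr_ge0.
have : 0 <= (C' - K) * a ^+ 2 by rewrite mulr_ge0 ?subr_ge0// sqr_ge0.
have : 0 <= (C - K) * b ^+ 2 by rewrite mulr_ge0 ?subr_ge0// sqr_ge0.
lra.
Qed.

End Coupling.

(** * Decay of the step sizes *)

Section StepSizes.
Context {R : realType}.

(** The increment [sqrt (s ^+ 2 + s) - s] is at least [c] exactly when
[s ^+ 2 + s >= (s + c) ^+ 2], i.e. [(1 - 2 * c) * s >= c ^+ 2]; this condition
persists because [s] grows. *)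
Lemma sqrt_recurrence_growth (s : nat -> R) (c : R) :
  (forall k, 0 < s k) -> (forall k, s k.+1 ^+ 2 = s k ^+ 2 + s k) ->
  0 <= c -> 2 * c <= 1 ->
  forall K, c ^+ 2 <= (1 - 2 * c) * s K -> forall n, s K + n%:R * c <= s (n + K)%N.
Proof.
move=> s0 sE c0 c1 K cK; elim=> [|n IHn]; first by rewrite mul0r addr0.
have : s (n + K)%N + c <= s (n + K).+1.
  have sn0 j : 0 <= s j by exact: ltW.
  rewrite -(@ler_pXn2r _ 2) ?nnegrE ?addr_ge0// sE.
  have : (1 - 2 * c) * s K <= (1 - 2 * c) * s (n + K)%N.
    rewrite ler_wpM2l ?subr_ge0//; apply: le_trans IHn.
    by rewrite lerDl mulr_ge0.
  lra.
by rewrite addSn -natr1; lra.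
Qed.

(** Growth is used twice: with a small constant [d], valid from index [0] on, it
shows that [s] is unbounded; then with some [c] strictly between [b] and
[1 / 2] from an index [K] on, the gap [c - b] making up for the first [K]
steps. *)
Lemma sqrt_recurrence_asymptotics (s : nat -> R) (b : R) :
  (forall k, 0 < s k) -> (forall k, s k.+1 ^+ 2 = s k ^+ 2 + s k) ->
  0 <= b -> 2 * b < 1 ->
  exists N0 : nat, forall N, (N0 <= N)%N -> N%:R * b <= s N.
Proof.
move=> s0 sE b0 b1; set c := (b + 2^-1) / 2.
have bc : b < c by rewrite /c; lra.
have c1 : 2 * c < 1 by rewrite /c; lra.
have [K cK] : exists K, c ^+ 2 <= (1 - 2 * c) * s K.
  (* The growth condition for d at s 0 reads d ^+ 2 <= d. *)
  set d := s 0%N / (1 + 2 * s 0%N); have s00 := s0 0%N.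
  have d0 : 0 < d by rewrite divr_gt0//; lra.
  have dE : (1 - 2 * d) * s 0%N = d by rewrite /d; field; lra.
  have dlt : 2 * d < 1 by rewrite /d mulrA ltr_pdivrMr; lra.
  have [n nlt] : exists n : nat, c ^+ 2 / (1 - 2 * c) / d < n%:R.
    exists (Num.truncn (c ^+ 2 / (1 - 2 * c) / d)).+1; exact: truncnS_gt.
  exists n; rewrite mulrC -ler_pdivrMr ?subr_gt0//.
  move: nlt; rewrite ltr_pdivrMr// => /ltW /le_trans; apply.
  have := sqrt_recurrence_growth s d s0 sE (ltW d0) (ltW dlt) 0%N.
  rewrite dE => /(_ _ n); rewrite addn0 => gr.
  apply: le_trans (gr _); first by rewrite lerDr ltW.
  by rewrite expr2 ger_pMr//; lra.
have c0 : 0 <= c by lra.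
have gr := sqrt_recurrence_growth s c s0 sE c0 (ltW c1) K cK.
exists (maxn K (Num.truncn (K%:R * c / (c - b))).+1) => N.
rewrite geq_max => /andP[KN MN].
have : K%:R * c <= N%:R * (c - b).
  rewrite -ler_pdivrMr ?subr_gt0//; apply: ltW; apply: lt_le_trans (truncnS_gt _) _.
  by rewrite ler_nat.
have := gr (N - K)%N; rewrite subnK// natrB//.
have := s0 K; lra.
Qed.

(** The numbers [(gamma * tau k)^-1] satisfy the recurrence above; any slope
[b < 1 / 2] is eventually reached, and [b ^+ 2 = (4 + 4 * eps)^-1] is the one
that corresponds to [eps].  The index [0] is excluded because the bound vanishes
there. *)
Lemma accelerated_step_rate (tau : nat -> R) (gamma eps : R) :
  0 < gamma -> 0 < eps -> (forall k, 0 < tau k) ->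
  (forall k, tau k.+1 ^+ 2 * (1 + gamma * tau k) = tau k ^+ 2) ->
  exists2 N0 : nat, (0 < N0)%N & forall N, (N0 <= N)%N ->
    tau N ^+ 2 <= (4 + 4 * eps) / N%:R ^+ 2 / gamma ^+ 2.
Proof.
move=> gamma_gt0 eps_gt0 tau_gt0 tau_sqr.
have g1_gt0 k : 0 < 1 + gamma * tau k by rewrite addr_gt0// mulr_gt0.
pose b := (2 * Num.sqrt (1 + eps))^-1.
have e1 : 0 < 1 + eps by lra.
have b2 : b ^+ 2 = (4 + 4 * eps)^-1.
  by rewrite /b exprVn exprMn sqr_sqrtr ?ltW//; congr (_^-1); lra.
have b0 : 0 < b by rewrite invr_gt0 mulr_gt0// sqrtr_gt0.
have b1 : 2 * b < 1.
  rewrite -(@ltr_pXn2r _ 2) ?nnegrE ?mulr_ge0 ?(ltW b0)// exprMn b2 expr1n.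
  by rewrite ltr_pdivrMr; lra.
have [N0 N0P] : exists N0 : nat, forall N, (N0 <= N)%N -> N%:R * b <= (gamma * tau N)^-1.
  apply: sqrt_recurrence_asymptotics (ltW b0) b1 => k.
    by rewrite invr_gt0 mulr_gt0.
  have := g1_gt0 k; have := tau_gt0 k; have := tau_gt0 k.+1.
  rewrite !exprVn !exprMn => t1 t2 g1.
  have -> : tau k.+1 ^+ 2 = tau k ^+ 2 / (1 + gamma * tau k).
    by rewrite -(tau_sqr k) mulfK// gt_eqF.
  by field; rewrite !gt_eqF.
exists N0.+1 => // N NN0.
have N_gt0 : (0 : R) < N%:R by rewrite ltr0n (leq_trans _ NN0).
have Nb := N0P _ (ltnW NN0).
have gt0 : 0 < gamma * tau N by rewrite mulr_gt0.
have : (N%:R * b) ^+ 2 <= (gamma * tau N) ^- 2.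
  rewrite -exprVn ler_pXn2r// nnegrE; first by rewrite mulr_ge0 ?(ltW b0).
  by rewrite invr_ge0 ltW.
rewrite exprMn b2 -lef_pV2 ?posrE ?invr_gt0 ?exprn_gt0//; last first.
  by rewrite mulr_gt0 ?invr_gt0 ?exprn_gt0//; lra.
rewrite invrK exprMn => H.
rewrite ler_pdivlMr ?exprn_gt0// mulrC; apply: le_trans H _.
rewrite le_eqVlt; apply/orP; left; apply/eqP; field.
by rewrite !gt_eqF//; lra.
Qed.

End StepSizes.

(** * The energy of the primal-dual iteration *)

Section Energy.
Context {R : realType} {X Y : normedModType R} (T : {linear X -> Y}).
Context (s C C' : R) (xbar : X) (pbar : dual Y).

(** Here [t] is the current primal step size and [r] the previous one, [v] is the
last increment of the primal iterate and [s] the invariant product of the two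
step sizes.  The pairing [(p - pbar) (T v)] is the part of the coupling that
telescopes, and the last term is what pays for the error of the next
extrapolation. *)
Definition energy (t r : R) (x v : X) (p : dual Y) : R :=
  bregman xbar x / t ^+ 2 + bregman pbar p / s
  + (p - pbar) (T v) / r + C / 2 * `|v| ^+ 2 / r ^+ 2.

Context (T_cont : continuous T) (s_gt0 : 0 < s).
Context (step : Num.sqrt s * opnorm T <= Num.min C C').
Context (breg_X : forall x u : X, C / 2 * `|x - u| ^+ 2 <= bregman x u).
Context (breg_Y' :
  forall q p : dual Y, C' / 2 * `|q - p| ^+ 2 <= bregman q p).

(** The indefinite term of the energy is dominated, through [coupling_bound], by
the dual Bregman distance together with the squared increment. *)
Lemma energy_lower_bound (t r : R) x v p : 0 < r ->
  bregman xbar x / t ^+ 2 <= energy t r x v p.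
Proof.
move=> r0; have := coupling_bound T C C' s r (p - pbar) v T_cont s_gt0 r0 step.
have := breg_Y' pbar p; rewrite (distrC pbar p) -(ler_pM2r (_ : 0 < s^-1)) ?invr_gt0//.
have := ler_norm (- ((p - pbar) (T v) / r)).
rewrite normrN normrM (gtr0_norm (_ : 0 < r^-1)) ?invr_gt0// /energy; lra.
Qed.

(** In the coupling [(p' - pbar) (T (x' - x)) / t - (p' - pbar) (T v) / r] the
first term belongs to the new energy; in the second, [p' - pbar] splits into
[p - pbar], which belongs to the old energy, and [p' - p], which is absorbed by
[bregman p' p] and the squared norm of [v]. *)
Lemma energy_decreases (f : X -> \bar R) (h : dual Y -> \bar R)
    (gamma sigma t t' r : R) (x x' v : X) (p p' : dual Y) :
  (forall u w w', subdiff f u w' ->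
    ((w' (w - u) + gamma * bregman w u)%:E <= f w - f u)%E) ->
  subdiff f xbar (- adjoint T_cont pbar) -> subdiff h pbar (evaluation (T xbar)) ->
  0 < t -> 0 < t' -> 0 < r -> sigma * t = s -> t' ^+ 2 * (1 + gamma * t) = t ^+ 2 ->
  resolvent h sigma
    (duality_map p + sigma *: evaluation (T (x + (t / r) *: v))) p' ->
  resolvent f t (duality_map x - t *: adjoint T_cont p') x' ->
  energy t' t x' (x' - x) p' <= energy t r x v p.
Proof.
move=> f_strong f_sol h_sol t0 t'0 r0 sigmat t'E p_step x_step.
have sigma0 : 0 < sigma by rewrite -(pmulr_lgt0 _ t0) sigmat.
rewrite -scalerN in x_step.
have Hx := resolvent_step f gamma t x x' xbar _ _ f_strong t0 f_sol x_step.
have h_convex u w w' : subdiff h u w' ->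
    ((w' (w - u) + 0 * bregman w u)%:E <= h w - h u)%E.
  by move=> hu; rewrite mul0r addr0; exact: hu.
have Hp := resolvent_step h 0 sigma p p' pbar _ _ h_convex sigma0 h_sol p_step.
have Bx := breg_X x' x; have Bp := breg_Y' p' p.
have := coupling_bound T C C' s r (p' - p) v T_cont s_gt0 r0 step.
have := ler_norm ((p' - p) (T v) / r).
rewrite [`|_ / r|]normrM (gtr0_norm (_ : 0 < r^-1)) ?invr_gt0//.
move: Hx Hp; rewrite mulr0 addr0 mul1r.
have TB : forall y z, T (y - z) = T y - T z by exact: linearB.
have TP a : T (x + a *: v) = T x + a *: T v by rewrite linearD linearZ.
have -> : (- adjoint T_cont p' - - adjoint T_cont pbar) (xbar - x') =
    (p' - pbar) (T (x' - xbar)).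
  by rewrite !(dualD, dualN, adjointE) !TB !dualB; lra.
have -> : (evaluation (T (x + (t / r) *: v)) - evaluation (T xbar)) (pbar - p') =
    - (p' - pbar) (T (x - xbar)) - t / r * (p' - pbar) (T v).
  by rewrite !(dualD, dualN, evaluationE) TP TB !dual_addZ !dualB; lra.
have -> : (p' - p) (T v) = (p' - pbar) (T v) - (p - pbar) (T v) :> R.
  by rewrite !(dualD, dualN); lra.
have -> : (p' - pbar) (T (x' - xbar)) =
    (p' - pbar) (T (x - xbar)) + (p' - pbar) (T (x' - x)) :> R.
  by rewrite !TB !dualB; lra.
have it2 : 0 < t ^- 2 by rewrite invr_gt0 exprn_gt0.
have is0 : 0 < s^-1 by rewrite invr_gt0.
rewrite -(ler_pM2r it2) => Hx; rewrite -(ler_pM2r is0) => Hp Hle Hcoupling.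
(* This is where t' is determined: t' ^- 2 = (1 + gamma * t) / t ^+ 2. *)
have {}Hx : bregman xbar x' / t' ^+ 2 + bregman x' x / t ^+ 2 +
    ((p' - pbar) (T (x - xbar)) + (p' - pbar) (T (x' - x))) / t <=
    bregman xbar x / t ^+ 2.
  have g0 : 1 + gamma * t != 0.
    by apply: contraTneq it2 => g0; rewrite -t'E g0 mulr0 invr0 ltxx.
  have -> : t' ^- 2 = (1 + gamma * t) * t ^- 2.
    by rewrite -t'E; field; rewrite g0 gt_eqF.
  apply: le_trans Hx; rewrite le_eqVlt; apply/orP; left; apply/eqP.
  by field; rewrite gt_eqF.
have {}Hp : bregman pbar p' / s + bregman p' p / s -
    (p' - pbar) (T (x - xbar)) / t - (p' - pbar) (T v) / r <= bregman pbar p / s.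
  apply: le_trans Hp; rewrite -sigmat le_eqVlt; apply/orP; left; apply/eqP.
  by field; rewrite !gt_eqF.
have {}Bx : C / 2 * `|x' - x| ^+ 2 / t ^+ 2 <= bregman x' x / t ^+ 2.
  by rewrite ler_pM2r.
have {}Bp : C' / 2 * `|p' - p| ^+ 2 / s <= bregman p' p / s by rewrite ler_pM2r.
rewrite /energy; lra.
Qed.

End Energy.

(** * The accelerated rate *)

Theorem theorem5 (R : realType) (X Y : completeNormedModType R)
  (X_refl : reflexive_space X) (X_smooth : smooth_space X) (X_2cvx : two_convex X)
  (Y'_refl : reflexive_space (dual Y)) (Y'_smooth : smooth_space (dual Y))
  (Y'_2cvx : two_convex (dual Y))
  (T : {linear X -> Y}) (T_cont : continuous T)
  (f : X -> \bar R) (g : Y -> \bar R)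
  (f_Gamma : Gamma f) (g_Gamma : Gamma g)
  (f_ge0 : forall x, (0 <= f x)%E) (g_ge0 : forall y, (0 <= g y)%E)
  (xbar : X) (pbar : dual Y)
  (solution : saddle_point (lagrangian T f g) xbar (- pbar))
  (CX CY' : R) (CX_gt0 : 0 < CX) (CY'_gt0 : 0 < CY')
  (breg_X : forall x u : X, CX / 2 * `|x - u| ^+ 2 <= bregman x u)
  (breg_Y' : forall q p : dual Y, CY' / 2 * `|q - p| ^+ 2 <= bregman q p)
  (gamma : R) (gamma_gt0 : 0 < gamma)
  (f_strong : forall (x u : X) (x' : dual X), subdiff f x x' ->
    ((x' (u - x) + gamma * bregman u x)%:E <= f u - f x)%E)
  (theta sigma tau : nat -> R) (sigma0_gt0 : 0 < sigma 0%N) (tau0_gt0 : 0 < tau 0%N)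
  (step : Num.sqrt (sigma 0%N * tau 0%N) * opnorm T <= Num.min CX CY')
  (thetaE : forall k, theta k = (Num.sqrt (1 + gamma * tau k))^-1)
  (tauE : forall k, tau k.+1 = theta k * tau k)
  (sigmaE : forall k, sigma k.+1 = (theta k)^-1 * sigma k)
  (x xhat : nat -> X) (p : nat -> dual Y)
  (xhat0 : xhat 0%N = x 0%N)
  (p_iter : forall k, resolvent (fenchel g) (sigma k)
     (duality_map (p k) + sigma k *: evaluation (T (xhat k))) (p k.+1))
  (x_iter : forall k, resolvent f (tau k)
     (duality_map (x k) - tau k *: adjoint T_cont (p k.+1)) (x k.+1))
  (xhat_iter : forall k, xhat k.+1 = x k.+1 + theta k *: (x k.+1 - x k)) :
  forall eps : R, 0 < eps -> exists N0 : nat, forall N : nat, (N0 <= N)%N ->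
    bregman xbar (x N) <= (4 + 4 * eps) / N%:R ^+ 2 *
      (bregman xbar (x 0%N) / (gamma ^+ 2 * tau 0%N ^+ 2) +
       bregman pbar (p 0%N) / (gamma ^+ 2 * sigma 0%N * tau 0%N)).
Proof.
have [f_sol g_sol] := (saddle_point_lagrangianP T_cont xbar pbar f_Gamma g_Gamma g_ge0).1 solution.
have tau_gt0 k : 0 < tau k.
  elim: k => [//|k IHk]; rewrite tauE thetaE mulr_gt0// invr_gt0 sqrtr_gt0.
  by rewrite addr_gt0// mulr_gt0.
have g1_gt0 k : 0 < 1 + gamma * tau k by rewrite addr_gt0// mulr_gt0.
have tau_sqr k : tau k.+1 ^+ 2 * (1 + gamma * tau k) = tau k ^+ 2.
  rewrite tauE thetaE exprMn exprVn sqr_sqrtr ?(ltW (g1_gt0 k))//.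
  by field; rewrite gt_eqF.
have sigma_tau k : sigma k * tau k = sigma 0%N * tau 0%N.
  elim: k => [//|k <-]; rewrite sigmaE tauE; field.
  by rewrite thetaE invr_eq0 sqrtr_eq0 -ltNge.
set s := sigma 0%N * tau 0%N in step sigma_tau.
have s_gt0 : 0 < s by rewrite mulr_gt0.
(* With the convention x 0.-1 = x 0, one formula covers the initial step. *)
have xhatE k : xhat k = x k + (tau k / tau k.-1) *: (x k - x k.-1).
  case: k => [|k] /=; first by rewrite subrr scaler0 addr0.
  by rewrite xhat_iter tauE mulfK// gt_eqF.
have energy_bound k : energy T s CX xbar pbar (tau k) (tau k.-1) (x k) (x k - x k.-1) (p k)
    <= bregman xbar (x 0%N) / tau 0%N ^+ 2 + bregman pbar (p 0%N) / s.
  elim: k => [|k IHk].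
    by rewrite /energy /= subrr !linear0 normr0; lra.
  apply: le_trans IHk.
  apply: (energy_decreases T s CX CY' xbar pbar T_cont s_gt0 step breg_X breg_Y'
    f (fenchel g) gamma (sigma k)) => //.
  by rewrite -xhatE.
move=> eps eps_gt0.
have [N0 N0_gt0 N0P] :=
  accelerated_step_rate tau gamma eps gamma_gt0 eps_gt0 tau_gt0 tau_sqr.
exists N0 => N NN0.
have N_gt0 : (0 : R) < N%:R by rewrite ltr0n (leq_trans N0_gt0).
have E0 : 0 <= bregman xbar (x 0%N) / tau 0%N ^+ 2 + bregman pbar (p 0%N) / s.
  have Bx0 : 0 <= bregman xbar (x 0%N).
    by apply: le_trans (breg_X _ _); rewrite mulr_ge0 ?divr_ge0 ?sqr_ge0// ltW.
  have Bp0 : 0 <= bregman pbar (p 0%N).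
    by apply: le_trans (breg_Y' _ _); rewrite mulr_ge0 ?divr_ge0 ?sqr_ge0// ltW.
  by rewrite addr_ge0// divr_ge0 ?sqr_ge0// ltW.
have bound : bregman xbar (x N) <=
    tau N ^+ 2 * (bregman xbar (x 0%N) / tau 0%N ^+ 2 + bregman pbar (p 0%N) / s).
  rewrite mulrC -ler_pdivrMr ?exprn_gt0//; apply: le_trans (energy_bound N).
  by apply: (energy_lower_bound T s CX CY').
apply: (le_trans bound); apply: (le_trans (ler_wpM2r E0 (N0P _ NN0))).
rewrite le_eqVlt; apply/orP; left; apply/eqP; rewrite /s; field.
by rewrite !gt_eqF.
Qed.
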